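(* Let $K$ be a field and let $G$ be a finite simple graph with no isolated vertices and matching number $\nu(G)$. Then the following statements are equivalent: (i) the complementary graph $G^c$ is disconnected; (ii) $g_{I(G)}(1)=0$; (iii) $g_{I(G)}(k)=0$ for all $1\leq k\leq \nu(G)$.
   Context: Let $G$ have vertex set $\{1,\ldots,n\}$ and let $S=K[x_1,\ldots,x_n]$. The edge ideal $I(G)\subset S$ is generated by all $x_ix_j$ with $\{i,j\}$ an edge of $G$. A $k$-matching is a set of $k$ pairwise disjoint edges, and $\nu(G)$ is the maximum size of a matching of $G$. For $k\ge1$, the $k$-th squarefree power $I(G)^{[k]}$ is the ideal generated by the squarefree monomials $x_{i_1}x_{j_1}\cdots x_{i_k}x_{j_k}$ where $\{i_1,j_1\},\ldots,\{i_k,j_k\}$ is a $k$-matching of $G$. It is generated in degree $2k$ and is nonzero exactly for $k\le\nu(G)$. For $1\le k\le \nu(G)$, $g_{I(G)}(k)=\operatorname{depth}(S/I(G)^{[k]})-(2k-1)$. *)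

(* Defs.v *)
From HB Require Import structures.
From mathcomp Require Import all_boot all_order all_algebra.
From mathcomp Require Import mpoly.
From mathcomp Require Import classical_sets.

Set Implicit Arguments.
Unset Strict Implicit.
Unset Printing Implicit Defensive.

Import GRing.Theory Num.Theory.
Local Open Scope classical_set_scope.
Local Open Scope ring_scope.

Section RegularSequences.
Variable R : comNzRingType.

Definition ideal_gen (A : set R) : set R :=
  [set p | exists s : seq (R * R),
     (forall u, u \in s -> A u.2) /\ p = \sum_(u <- s) u.1 * u.2].

(** The class of [f] is not a zero divisor on [R / J]. *)
Definition regular_mod (J : set R) (f : R) : Prop :=
  forall g : R, J (f * g) -> J g.

(** [s] is a regular sequence on the R-module [R / J]; the module
    [R / (J + (f_1, ..., f_i))] is handled through the ideal
    [J + (f_1, ..., f_i)] of [R]. *)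
Definition regular_seq (J : set R) (s : seq R) : Prop :=
  let Js i := ideal_gen (J `|` [set` take i s]) in
  (forall i, (i < size s)%N -> regular_mod (Js i) s`_i) /\ ~ Js (size s) 1.

End RegularSequences.

Section Depth.
Variables (n : nat) (K : fieldType).
Local Notation S := {mpoly K[n]}.

Definition irrelevant_ideal : set S := ideal_gen [set p | exists i, p = 'X_i].

Definition regular_length (J : set S) (d : nat) : Prop :=
  exists s : seq S,
    [/\ size s = d, forall f, f \in s -> irrelevant_ideal f & regular_seq J s].

(** depth of [S / J] with respect to the irrelevant ideal: the maximal length
    of a regular sequence on [S / J] inside it.  The default value 0 would
    only be used if there were no such maximum, e.g. if [S / J] is zero. *)
Definition depth (J : set S) : nat :=
  xget 0%N [set d | regular_length J d /\
                    forall d', regular_length J d' -> (d' <= d)%N].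

End Depth.

Section Graphs.
Variables (n : nat) (e : rel 'I_n).

Definition simple_graph : Prop := ssrbool.symmetric e /\ irreflexive e.

Definition no_isolated : Prop := forall i, exists j, e i j.

Definition compl_graph : rel 'I_n := fun i j => (i != j) && ~~ e i j.

Definition connected_graph : Prop := forall i j, connect e i j.

Definition edges : {set {set 'I_n}} :=
  [set A | [exists i, exists j, e i j && (A == [set i; j]%SET)]]%SET.

Definition matching (M : {set {set 'I_n}}) : bool :=
  (M \subset edges) && finset.trivIset M.

Definition matching_number : nat := (\max_(M | matching M) #|M|)%N.

End Graphs.

Section SquarefreePowers.
Variables (n : nat) (K : fieldType) (e : rel 'I_n).
Local Notation S := {mpoly K[n]}.

(** The [k]-th squarefree power of the edge ideal of [e]. *)
Definition sqfree_power (k : nat) : set S :=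
  ideal_gen [set p | exists M : {set {set 'I_n}},
    [/\ matching e M, #|M| = k & p = \prod_(A in M) \prod_(i in A) 'X_i]].

(** [g_{I(G)}(k)]; the subtraction takes place in [int], not in [nat]. *)
Definition norm_depth (k : nat) : int :=
  (depth (sqfree_power k))%:Z - (2 * k%:Z - 1).

End SquarefreePowers.

Arguments sqfree_power n K e k : clear implicits.
Arguments norm_depth n K e k : clear implicits.

(* Main.v *)
Require Import Defs.
From mathcomp Require Import boolp classical_sets.
From mathcomp Require Import all_boot all_order all_algebra.
From mathcomp Require Import mpoly ring zify.

(** Let [J_k] be the [k]-th squarefree power and [Delta_k] the simplicial
    complex of the vertex sets that contain no [k]-matching: [J_k] is the
    Stanley-Reisner ideal of [Delta_k] ([sqfree_powerE]).

    For [k] at most the matching number, the depth is at least [2k - 1].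
    Every set of fewer than [2k] vertices is a face of [Delta_k], and whenever
    all sets of at most [d <= n] vertices are faces, the complete homogeneous symmetric polynomials
    [h_1, ..., h_d] form a regular sequence on the face ring
    ([regular_rec_complete_sym_skeleton]); being explicit, they serve over
    finite fields as well, where generic linear forms do not exist.  The proof
    removes the last variable [x]: multiplication by [x] places [S / J] between
    [S / (J : x)], which comes from the link of [x], and [S / (J, x)], which
    comes from its deletion, and the identity
    [h_(j+1)(Y, x) = x h_j(Y, x) + h_(j+1)(Y)] turns the sequence in [Y, x]
    into the sequences in [Y] that the induction hypothesis provides.

    Suppose that the complement of [G] is disconnected, and let [A] be one of
    its components: in [G], every vertex of [A] is joined to every vertex
    outside [A].  An exchange argument gives a [(k-1)]-matching [N] that leaves
    a vertex free in [A] and another one free outside [A]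
    ([exists_avoiding_matching]).  Let [F] be the set of the [2k - 2] vertices
    of [N].  Adding to [N] an edge from [A] to its outside gives a
    [k]-matching, so the link of [F] in [Delta_k] is disconnected.  Its reduced
    cohomology in degree [0] yields local cohomology of [S / J_k] in degree
    [2k - 1], represented here by an explicit Koszul cocycle on the squares of
    the variables ([disconnected_link_koszul]).  Dividing by a nonzerodivisor
    lowers by one the degree of a nonzero Koszul class ([koszul_descent]), so
    no regular sequence in the irrelevant ideal has more than [2k - 1] terms.

    Suppose that the complement of [G] is connected.  Its edges are faces of
    [Delta_1], and then [h_1, h_2] is a regular sequence
    ([regular_rec_complete_sym_connected]).  Indeed, if [h_1] divides [h_2 g]
    modulo [J_1], then it divides [g] on each face with two or more vertices;
    the quotients agree on common nonempty faces, and their constant terms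
    agree because of connectedness, so they glue to a quotient modulo [J_1].
    Hence the depth of [S / J_1] is not [1]. *)

Set Implicit Arguments.
Unset Strict Implicit.
Unset Printing Implicit Defensive.

Import GRing.Theory.
Local Open Scope ring_scope.

(** * Regular sequences modulo ideals *)

Section Ideals.
Variable R : comNzRingType.
Implicit Types (I J : set R) (s : seq R).

(** Ideals are kept as predicates, as in the definition of a regular sequence,
    so that the ideals met below can be given by conditions on coefficients. *)
Definition is_ideal I :=
  [/\ I 0, forall a b, I a -> I b -> I (a + b) & forall a b, I b -> I (a * b)].

Lemma idealN I a : is_ideal I -> I a -> I (- a).
Proof. by case=> _ _ IM Ia; rewrite -mulN1r; apply: IM. Qed.

Lemma idealB I a b : is_ideal I -> I a -> I b -> I (a - b).
Proof. by move=> idI Ia Ib; case: (idI) => _ ID _; apply: ID => //; apply: idealN. Qed.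

Lemma ideal_mulr I a b : is_ideal I -> I a -> I (a * b).
Proof. by case=> _ _ IM Ia; rewrite mulrC; apply: IM. Qed.

Lemma ideal_sum I (T : Type) (r : seq T) (P : pred T) (F : T -> R) :
  is_ideal I -> (forall i, P i -> I (F i)) -> I (\sum_(i <- r | P i) F i).
Proof. by case=> I0 ID _ IF; apply: (big_ind (fun p => I p)). Qed.

Lemma ideal_shift I a b : is_ideal I -> I (a - b) -> I a -> I b.
Proof.
move=> idI Iab Ia; have -> : b = a - (a - b) by rewrite opprB addrC subrK.
exact: idealB.
Qed.

Definition adjoin I f : set R :=
  fun p => exists2 a, I a & exists b, p = a + b * f.

Lemma adjoin_ideal I f : is_ideal I -> is_ideal (adjoin I f).
Proof.
case=> I0 ID IM; split.
- by exists 0 => //; exists 0; rewrite mul0r addr0.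
- move=> _ _ [a Ia [b ->]] [a' Ia' [b' ->]].
  by exists (a + a'); [exact: ID | exists (b + b'); rewrite mulrDl addrACA].
- move=> c _ [a Ia [b ->]].
  by exists (c * a); [exact: IM | exists (c * b); rewrite mulrDr mulrA].
Qed.

Lemma sub_adjoin I f p : I p -> adjoin I f p.
Proof. by exists p => //; exists 0; rewrite mul0r addr0. Qed.

Lemma mem_adjoin I f : is_ideal I -> adjoin I f f.
Proof. by case=> I0 _ _; exists 0 => //; exists 1; rewrite add0r mul1r. Qed.

Lemma adjoin_min I K f p :
  is_ideal K -> (forall a, I a -> K a) -> K f -> adjoin I f p -> K p.
Proof. by case=> _ KD KM IK Kf [a Ia [b ->]]; apply: KD; [apply: IK | apply: KM]. Qed.

Lemma adjoin_eq_class I f g :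
  is_ideal I -> I (f - g) -> adjoin I f = adjoin I g.
Proof.
move=> idI Ifg; apply/predeqP => p; split; apply: adjoin_min => //.
- exact: adjoin_ideal.
- exact: sub_adjoin.
- apply: (ideal_shift (adjoin_ideal g idI) _ (mem_adjoin g idI)).
  by apply: sub_adjoin; rewrite -opprB; apply: idealN.
- exact: adjoin_ideal.
- exact: sub_adjoin.
- apply: (ideal_shift (adjoin_ideal f idI) _ (mem_adjoin f idI)).
  exact: sub_adjoin.
Qed.

Lemma adjoinC I f g : adjoin (adjoin I f) g = adjoin (adjoin I g) f.
Proof.
apply/predeqP => p; split=> [] [_ [a Ia [b ->]] [c ->]].
  by exists (a + c * g); [exists a => //; exists c | exists b; rewrite addrAC].
by exists (a + c * f); [exists a => //; exists c | exists b; rewrite addrAC].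
Qed.

Lemma regular_mod_class I f g :
  is_ideal I -> I (f - g) -> regular_mod I f -> regular_mod I g.
Proof.
move=> idI Ifg reg p Igp; apply: reg; apply: (ideal_shift idI _ Igp).
by rewrite -mulrBl; apply: ideal_mulr => //; rewrite -opprB; apply: idealN.
Qed.

(** The form of regularity that suits induction: each element is tested modulo
    the ideal enlarged by its predecessors. Properness of the final ideal is
    kept apart, because it does not pass to the colon ideals used below. *)
Fixpoint regular_rec I s : Prop :=
  if s is f :: s' then regular_mod I f /\ regular_rec (adjoin I f) s' else True.

Lemma ideal_gen_ideal (A : set R) : is_ideal (ideal_gen A).
Proof.
split.
- by exists [::]; split=> //; rewrite big_nil.
- move=> _ _ [s [sA ->]] [t [tA ->]]; exists (s ++ t); rewrite big_cat; split=> // u.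
  by rewrite mem_cat => /orP[/sA|/tA].
- move=> a _ [s [sA ->]]; exists [seq (a * u.1, u.2) | u <- s]; split.
    by move=> u /mapP[v /sA Av ->].
  by rewrite big_map mulr_sumr; apply: eq_bigr => u _; rewrite mulrA.
Qed.

Lemma mem_ideal_gen (A : set R) p : A p -> ideal_gen A p.
Proof.
move=> Ap; exists [:: (1, p)]; rewrite big_seq1 mul1r; split=> // u.
by rewrite inE => /eqP ->.
Qed.

Lemma ideal_gen_min (A I : set R) p :
  is_ideal I -> (forall a, A a -> I a) -> ideal_gen A p -> I p.
Proof.
move=> idI AI [s [sA ->]]; rewrite big_seq; apply: ideal_sum => // u /sA Au.
by case: idI => _ _ IM; apply/IM/AI.
Qed.

Lemma ideal_gen_foldl J s : is_ideal J ->
  ideal_gen (J `|` [set` s])%classic = foldl adjoin J s.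
Proof.
move=> idJ; elim/last_ind: s => [|s f IH].
  apply/predeqP => p; split; last by move=> Jp; apply: mem_ideal_gen; left.
  by apply: ideal_gen_min => // a [].
rewrite foldl_rcons -IH; apply/predeqP => p.
have idL := ideal_gen_ideal (J `|` [set` s])%classic.
have idR := ideal_gen_ideal (J `|` [set` rcons s f])%classic.
split.
  apply: ideal_gen_min => [|a]; first exact: adjoin_ideal.
  case=> [Ja|]; first by apply/sub_adjoin/mem_ideal_gen; left.
  rewrite /= mem_rcons inE => /orP[/eqP -> | sa]; first exact: mem_adjoin.
  by apply/sub_adjoin/mem_ideal_gen; right.
apply: adjoin_min => [//|a|].
  apply: ideal_gen_min => // b [Jb|sb]; apply: mem_ideal_gen; first by left.
  by right; rewrite /= mem_rcons inE sb orbT.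
by apply: mem_ideal_gen; right; rewrite /= mem_rcons mem_head.
Qed.

Lemma foldl_adjoin_min I J s p :
  is_ideal J -> (forall a, I a -> J a) -> (forall f, f \in s -> J f) ->
  foldl adjoin I s p -> J p.
Proof.
elim: s I => [|f s IH] I idJ subIJ sJ /=; first exact: subIJ.
apply: IH => // [a|g gs]; last by apply: sJ; rewrite inE gs orbT.
by apply: adjoin_min => //; apply: sJ; rewrite mem_head.
Qed.

Lemma regular_recP J s :
  regular_rec J s <-> forall i, (i < size s)%N -> regular_mod (foldl adjoin J (take i s)) s`_i.
Proof.
elim: s J => [|f s IH] J //=; split.
  by case=> fJ /IH sJ [|i] //= ?; apply: sJ.
by move=> H; split; [exact: (H 0%N) | apply/IH => i; apply: (H i.+1)].
Qed.

Lemma regular_seqE J s : is_ideal J ->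
  regular_seq J s <-> regular_rec J s /\ ~ foldl adjoin J s 1.
Proof.
move=> idJ; rewrite /regular_seq regular_recP ideal_gen_foldl // take_size.
by split=> [] [H1 H2]; split=> // i /H1; rewrite ideal_gen_foldl.
Qed.

Definition colon I x : set R := fun p => I (x * p).

(** Multiplication by [x] gives an exact sequence from [R / (I : x)] to [R /
    I] to [R / (I, x)]. A sequence that is regular on both ends is regular in
    the middle, and the exact sequence survives the passage to the quotient by
    each of its elements, since that element is regular on the right end. *)
Lemma regular_rec_colon_adjoin I x s : is_ideal I ->
  regular_rec (colon I x) s -> regular_rec (adjoin I x) s -> regular_rec I s.
Proof.
elim: s I => [|f s IH] I idI //= [regC rsC] [regA rsA].
have [I0 ID IM] := idI.
split=> [g Ifg|].
  have [a Ia [b def_g]] := regA g (sub_adjoin x Ifg).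
  rewrite def_g; apply: ID => //; rewrite mulrC; apply: (regC b); rewrite /colon.
  rewrite mulrCA (mulrC x).
  have -> : f * (b * x) = f * g - f * a by rewrite def_g mulrDr addrAC subrr add0r.
  by apply: idealB => //; apply: IM.
apply: IH; first exact: adjoin_ideal.
  suff <- : adjoin (colon I x) f = colon (adjoin I f) x by [].
  apply/predeqP => p; split.
    case=> a Ixa [b ->]; exists (x * a) => //; exists (x * b).
    by rewrite mulrDr mulrA.
  case=> a Ia [c eq_xp].
  have [a' Ia' [c' def_c]] : adjoin I x c.
    apply: regA; rewrite mulrC.
    have -> : c * f = - a + p * x by rewrite [p * x]mulrC eq_xp addKr.
    by exists (- a); [exact: idealN | exists p].
  exists (p - f * c'); last by exists c'; rewrite [c' * f]mulrC subrK.
  have -> : colon I x (p - f * c') = I (a + a' * f).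
    by rewrite /colon mulrBr eq_xp def_c; congr I; ring.
  by apply: ID => //; apply: ideal_mulr.
by rewrite adjoinC.
Qed.

Lemma regular_rec_unit_ideal I s : is_ideal I -> I 1 -> regular_rec I s.
Proof.
elim: s I => //= f s IH I idI I1; split; last first.
  by apply: IH; [exact: adjoin_ideal | exact: sub_adjoin].
by move=> g _; rewrite -[g]mulr1; case: idI => _ _; apply.
Qed.

End Ideals.

(** A surjection identifies [R] modulo the preimage of [I] with [R'] modulo
    [I], so regularity can be tested after applying it. *)
Lemma regular_rec_preim (R R' : comNzRingType) (phi : {rmorphism R -> R'})
    (I : set R') (s : seq R) :
  (forall q, exists p, phi p = q) ->
  regular_rec I (map phi s) -> regular_rec (fun p => I (phi p)) s.
Proof.
move=> surj; elim: s I => //= f s IH I [reg rs]; split.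
  by move=> g; rewrite rmorphM => /reg.
suff -> : adjoin (fun p => I (phi p)) f = (fun p => adjoin I (phi f) (phi p)).
  exact: IH.
apply/predeqP => p; split.
  by case=> a Ia [b ->]; exists (phi a) => //; exists (phi b); rewrite rmorphD rmorphM.
case=> a Ia [b eq_p]; have [b' def_b] := surj b.
exists (p - b' * f); last by exists b'; rewrite subrK.
by rewrite rmorphB rmorphM def_b eq_p addrK.
Qed.

(** * Adjoining one variable *)

Section OneMoreVariable.
Variable R : comNzRingType.
Implicit Types (I J : set R) (f p q : {poly R}).

Definition poly_ideal I : set {poly R} := fun p => forall i, I p`_i.

(** The ideal [J0 + x J1 R[x]]: a face ideal has this form with respect to its
    last variable, with the ideals of the deletion and of the link. *)
Definition xsplit_ideal J0 J1 : set {poly R} :=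
  fun p => J0 p`_0 /\ forall i, J1 p`_i.+1.

Lemma xsplit_ideal_ideal J0 J1 : is_ideal J0 -> is_ideal J1 -> (forall a, J0 a -> J1 a) ->
  is_ideal (xsplit_ideal J0 J1).
Proof.
move=> id0 id1 sub01; have [J00 J0D J0M] := id0; have [J10 J1D J1M] := id1; split.
- by split=> [|i]; rewrite coef0.
- by move=> p q [p0 p1] [q0 q1]; split=> [|i]; rewrite coefD; auto.
- move=> p q [q0 q1]; split=> [|i]; rewrite coefM; apply: ideal_sum => // j _.
    by rewrite sub0n; apply: J0M.
  by apply: J1M; case: (i.+1 - j)%N => // ; apply: sub01.
Qed.

Lemma poly_ideal_E I : poly_ideal I = xsplit_ideal I I.
Proof. by apply/predeqP => p; split=> [pI|[p0 p1] [|i]] //; split=> // i. Qed.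

Lemma poly_ideal_ideal I : is_ideal I -> is_ideal (poly_ideal I).
Proof. by move=> idI; rewrite poly_ideal_E; apply: xsplit_ideal_ideal. Qed.

(** Read from the top, the coefficients of [q * f] are those of [q] plus
    combinations of higher coefficients of [q]; descending induction then
    gives that all of them are in [I]. *)
Lemma monic_coefs_ideal I f q : is_ideal I -> f \is monic ->
  (forall i, ((size f).-1 <= i)%N -> I (q * f)`_i) -> poly_ideal I q.
Proof.
move=> idI fmon qfI.
have [I0 ID IM] := idI.
suff Hk k i : (size q <= i + k)%N -> I q`_i by move=> i; apply: (Hk (size q)); rewrite leq_addl.
elim: k i => [|k IH] i; first by rewrite addn0 => /leq_sizeP ->.
move=> le_q; set m := (size f).-1.
have := qfI (i + m)%N (leq_addl _ _).
have lt_i : (i < (i + m).+1)%N by rewrite ltnS leq_addr.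
rewrite coefM (bigD1 (Ordinal lt_i)) //= addKn.
have -> : f`_m = 1 by apply/eqP; rewrite -lead_coefE -monicE.
rewrite mulr1 => Hs; set rest := (X in _ + X) in Hs; rewrite -[q`_i](addrK rest).
apply: idealB => //; apply: ideal_sum => // j ne_ji.
have [lt_ji|le_ij] := ltnP j i.
  rewrite [f`__]nth_default ?mulr0 //.
  rewrite -addnBAC ?(ltnW lt_ji) // -[leqLHS]prednK ?size_poly_gt0 ?monic_neq0 //.
  by rewrite -/m -add1n leq_add2r subn_gt0.
have lt_ij : (i < j)%N by rewrite ltn_neqAle le_ij andbT eq_sym.
apply: ideal_mulr => //; apply: IH; apply: leq_trans le_q _.
by rewrite addnS -addSn leq_add2r.
Qed.

Lemma regular_monic I f : is_ideal I -> f \is monic -> regular_mod (poly_ideal I) f.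
Proof.
by move=> idI fmon g fgI; apply: monic_coefs_ideal fmon _ => // i _; rewrite mulrC.
Qed.

Lemma poly_ideal_adjoin I a : is_ideal I -> poly_ideal (adjoin I a) = adjoin (poly_ideal I) a%:P.
Proof.
move=> idI; have [I0 ID IM] := idI; have idP := poly_ideal_ideal idI.
apply/predeqP => p; split; last first.
  case=> q qI [r ->] i; rewrite coefD coefMC; exists q`_i => //; by exists r`_i.
move=> pI; rewrite -[p]coefK poly_def; apply: ideal_sum; first exact: adjoin_ideal.
move=> i _; have [b bI [c ->]] := pI i; exists (b *: 'X^i).
  by move=> j; rewrite coefZ; apply: ideal_mulr.
by exists (c *: 'X^i); rewrite scalerDl [_ * a%:P]mulrC mul_polyC scalerA [a * c]mulrC.
Qed.

(** For [f] monic, [(R / I)[x] / (f)] is free over [R / I], with the powers of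
    [x] below the degree of [f] as a basis; hence elements of [R] that are
    regular on [R / I] stay regular. *)
Lemma regular_rec_mod_monic I f s : is_ideal I -> f \is monic -> regular_rec I s ->
  regular_rec (adjoin (poly_ideal I) f) (map polyC s).
Proof.
move=> + fmon; elim: s I => //= a s IH I idI [reg_a rs]; have idP := poly_ideal_ideal idI.
split; last by rewrite adjoinC -poly_ideal_adjoin //; apply: IH => //; apply: adjoin_ideal.
move=> p; rewrite {2}(Pdiv.RingMonic.rdivp_eq fmon p).
set q := Pdiv.Ring.rdivp p f; set r := Pdiv.Ring.rmodp p f => -[u uI [v eq_ap]].
have le_r : (size r <= (size f).-1)%N.
  by rewrite -ltnS prednK ?size_poly_gt0 ?Pdiv.Ring.ltn_rmodp monic_neq0.
have eq_ar : a%:P * r = u + (v - a%:P * q) * f.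
  have -> : a%:P * r = (a%:P * p) - a%:P * (q * f).
    by rewrite {1}(Pdiv.RingMonic.rdivp_eq fmon p) -/q -/r; ring.
  by rewrite eq_ap; ring.
have wI : poly_ideal I (v - a%:P * q).
  apply: monic_coefs_ideal fmon _ => // i le_i.
  have -> : ((v - a%:P * q) * f)`_i = - u`_i + a * r`_i.
    by rewrite -coefCM eq_ar coefD addKr.
  have [I0 ID IM] := idI; apply: ID; first exact: (idealN idI (uI i)).
  by rewrite nth_default ?mulr0 //; apply: leq_trans le_i.
have rI : poly_ideal I r.
  suff arI : poly_ideal I (a%:P * r) by move=> i; apply: reg_a; rewrite -coefCM.
  rewrite eq_ar.
  by case: (idP) => _ PD _; exact: (PD _ _ uI (ideal_mulr f idP wI)).
by exists r => //; exists q; rewrite addrC.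
Qed.

Lemma colon_xsplit J0 J1 : is_ideal J0 -> colon (xsplit_ideal J0 J1) 'X = poly_ideal J1.
Proof.
case=> J00 _ _; apply/predeqP => p; rewrite /colon mulrC; split=> [[_ p1] i|p1].
  by have := p1 i; rewrite coefMX.
by split=> [|i]; rewrite coefMX /=; auto.
Qed.

Lemma adjoin_xsplit J0 J1 : is_ideal J0 -> is_ideal J1 ->
  adjoin (xsplit_ideal J0 J1) 'X = (fun p => J0 (horner_eval 0 p)).
Proof.
case=> J00 _ _ [J10 _ _]; apply/predeqP => p; rewrite /= horner_evalE horner_coef0; split.
  by case=> a [a0 _] [b ->]; rewrite coefD coefMX addr0.
elim/poly_ind: p => [_|p c _].
  by exists 0; [split=> [|i]; rewrite coef0 | exists 0; rewrite mul0r addr0].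
rewrite coefD coefMX coefC add0r /= => J0c.
exists c%:P; last by exists p; rewrite addrC.
by split=> [|i]; rewrite coefC.
Qed.

Section Sequence.
Variables (f : nat -> {poly R}) (g : nat -> R).
Hypotheses (f0 : f 0 = 1) (fS : forall j, f j.+1 = 'X * f j + (g j.+1)%:P).

(** The recurrence is the one of the complete homogeneous symmetric
    polynomials when a variable is singled out: [f j] is [h_j] in all the
    variables and [g j] is [h_j] in the others. *)
Lemma recurrence_monic j : f j \is monic.
Proof.
suff: f j \is monic /\ size (f j) = j.+1 by case.
elim: j => [|j [mon_fj size_fj]]; first by rewrite f0 monic1 size_poly1.
have fj0 : f j != 0 by rewrite monic_neq0.
have lt_s : (size (g j.+1)%:P < size ('X * f j)%R)%N.
  by rewrite mulrC size_mulX // size_fj ltnS size_polyC; case: (_ == _).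
rewrite fS; split; last by rewrite size_polyDl // mulrC size_mulX // size_fj.
by rewrite monicE lead_coefDl // mulrC lead_coefMX -monicE.
Qed.

(** Once [f j] vanishes in the quotient, the recurrence makes [f j.+1] equal
    to [g j.+1]; step by step, the two sequences become interchangeable. *)
Lemma regular_rec_shift (I' : set {poly R}) j c : is_ideal I' -> I' (f j) ->
  regular_rec I' [seq (g i)%:P | i <- iota j.+1 c] -> regular_rec I' [seq f i | i <- iota j.+1 c].
Proof.
elim: c j I' => [|c IH] j I' idI' fjI //= [reg_g rs].
have fgI : I' ((g j.+1)%:P - f j.+1).
  rewrite fS opprD addrCA subrr addr0; apply: idealN => //.
  by case: idI' => _ _; apply.
split; first exact: regular_mod_class reg_g.
rewrite -(adjoin_eq_class idI' fgI); apply: IH => //; first exact: adjoin_ideal.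
by rewrite (adjoin_eq_class idI' fgI); apply: mem_adjoin.
Qed.

(** The case of a cone over the complex of [J]: the first element is monic in
    the new variable, and after it the other ones may be replaced by elements
    of [R]. *)
Lemma regular_rec_cone J s c : is_ideal J ->
  regular_rec J [seq g i | i <- iota s.+1 c] ->
  regular_rec (poly_ideal J) [seq f i | i <- iota s c.+1].
Proof.
move=> idJ rs; have idP := poly_ideal_ideal idJ; have mon := recurrence_monic s; split.
  exact: regular_monic.
apply: regular_rec_shift; [exact: adjoin_ideal | exact: mem_adjoin |].
by rewrite (map_comp polyC g); apply: regular_rec_mod_monic.
Qed.

(** The inductive step: the colon ideal by [x] is the ideal of the cone over
    the link, which accounts for one more element, and setting [x = 0] leaves
    the deletion. *)
Lemma regular_rec_link_del J0 J1 s c : is_ideal J0 -> is_ideal J1 -> (forall a, J0 a -> J1 a) ->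
  regular_rec J1 [seq g i | i <- iota s.+2 c] -> regular_rec J0 [seq g i | i <- iota s.+1 c.+1] ->
  regular_rec (xsplit_ideal J0 J1) [seq f i | i <- iota s.+1 c.+1].
Proof.
move=> id0 id1 sub01 rs1 rs0; have idP := xsplit_ideal_ideal id0 id1 sub01.
apply: (regular_rec_colon_adjoin (x := 'X)) => //.
  by rewrite colon_xsplit //; apply: regular_rec_cone.
rewrite adjoin_xsplit //; apply: regular_rec_preim.
  by move=> a; exists a%:P; rewrite /= /horner_eval hornerC.
suff -> : [seq horner_eval 0 p | p <- [seq f i | i <- iota s.+1 c.+1]]
        = [seq g i | i <- iota s.+1 c.+1] by [].
rewrite -map_comp; apply/eq_in_map => -[|i]; rewrite mem_iota //= => _.
by rewrite /horner_eval fS hornerD hornerM hornerX mul0r hornerC add0r.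
Qed.

End Sequence.
End OneMoreVariable.

(** * Face ideals and complete homogeneous polynomials *)

Section FaceIdeal.
Variables (n : nat) (K : fieldType).
Local Notation S := {mpoly K[n]}.
Implicit Types (Delta : {set 'I_n} -> Prop) (m : 'X_{1..n}) (p q : S).

Definition varset m : {set 'I_n} := [set i | m i != 0]%SET.

Lemma varsetD m1 m2 : varset (m1 + m2)%MM = varset m1 :|: varset m2.
Proof. by apply/setP => i; rewrite !inE mnmDE addn_eq0 negb_and. Qed.

Definition down_closed Delta := forall A B : {set 'I_n}, A \subset B -> Delta B -> Delta A.

(** The Stanley-Reisner ideal of [Delta], given by coefficients: its elements
    have no monomial supported on a face. A predicate in [Prop] is enough, and
    allows void complexes, whose ideal is the unit ideal. *)
Definition face_ideal Delta : set S := fun p => forall m, Delta (varset m) -> p@_m = 0.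

Lemma face_ideal_ideal Delta : down_closed Delta -> is_ideal (face_ideal Delta).
Proof.
move=> downD; split.
- by move=> m _; rewrite mcoeff0.
- by move=> p q pI qI m Dm; rewrite mcoeffD pI ?qI ?addr0.
- move=> p q qI m Dm; rewrite mcoeffM big1 // => -[m1 m2] /= /eqP def_m.
  rewrite qI ?mulr0 //; apply: downD Dm.
  by rewrite [X in _ \subset varset X]def_m varsetD subsetUr.
Qed.

Definition complete_sym j : S := \sum_(m : 'X_{1..n < j.+1} | mdeg m == j) 'X_[m].

Lemma mcoeff_complete_sym j m : (complete_sym j)@_m = (mdeg m == j)%:R.
Proof.
rewrite raddf_sum /=; have [def_j|ne_j] := eqVneq (mdeg m) j; last first.
  rewrite big1 // => m' /eqP def_j; rewrite mcoeffX; case: eqP => // def_m.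
  by rewrite -def_m def_j eqxx in ne_j.
have lt_m : (mdeg m < j.+1)%N by rewrite def_j.
rewrite (bigD1 (BMultinom lt_m)) /= ?def_j // mcoeffX eqxx big1 ?addr0 // => m' /andP[_ ne_m].
rewrite mcoeffX; case: (@eqP _ (bmnm m') m) => // def_m.
by rewrite -val_eqE /= def_m eqxx in ne_m.
Qed.

Lemma complete_sym0 : complete_sym 0 = 1.
Proof. by apply/mpolyP => m; rewrite mcoeff_complete_sym mcoeff1 mdeg_eq0. Qed.

End FaceIdeal.

Arguments complete_sym {n K} j.

Section LastVariable.
Variables (n : nat) (K : fieldType).
Local Notation W := (widen_ord (leqnSn n)).
Implicit Types (Delta : {set 'I_n.+1} -> Prop) (m : 'X_{1..n}).

(** Monomials in [n.+1] variables, in the form in which they match the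
    coefficients of [muni]. *)
Definition mnm_rcons m (i : nat) : 'X_{1..n.+1} := [multinom of rcons m i].

Lemma mnm_rcons_max m i : mnm_rcons m i ord_max = i.
Proof. by rewrite multinomE (tnth_nth 0%N) /= nth_rcons size_tuple ltnn eqxx. Qed.

Lemma mnm_rcons_widen m i j : mnm_rcons m i (W j) = m j.
Proof.
by rewrite !(mnm_nth 0%N) /= nth_rcons size_tuple /= ltn_ord.
Qed.

Lemma widen_inj : injective W.
Proof. by move=> i j /(congr1 val) /= eq_ij; apply: val_inj. Qed.

Lemma widen_neq_max j : (W j == ord_max) = false.
Proof. by rewrite -val_eqE /= (ltn_eqF (ltn_ord j)). Qed.

Lemma max_notin_widen (A : {set 'I_n}) : ord_max \notin (W @: A)%SET.
Proof. by apply/imsetP => -[j _ /esym/eqP]; rewrite widen_neq_max. Qed.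

Lemma ord_max_or_widen (i : 'I_n.+1) : i = ord_max \/ exists j, i = W j.
Proof.
have [lt_in|le_ni] := ltnP i n; first by right; exists (Ordinal lt_in); apply: val_inj.
by left; apply: val_inj; apply/eqP; rewrite eqn_leq -ltnS ltn_ord.
Qed.

Lemma mnm_rconsP (m : 'X_{1..n.+1}) : exists m' i, m = mnm_rcons m' i.
Proof.
exists [multinom m (W j) | j < n], (m ord_max); apply/mnmP => i.
by have [->|[j ->]] := ord_max_or_widen i; rewrite ?mnm_rcons_max // mnm_rcons_widen mnmE.
Qed.

Lemma mdeg_rcons m i : mdeg (mnm_rcons m i) = (mdeg m + i)%N.
Proof.
rewrite !mdegE big_ord_recr /= mnm_rcons_max; congr (_ + _)%N.
by apply: eq_bigr => j _; rewrite mnm_rcons_widen.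
Qed.

Lemma mcoeff_muni (p : {mpoly K[n.+1]}) m i :
  ((muni p)`_i)@_m = p@_(mnm_rcons m i).
Proof.
rewrite muniE [in RHS](mpolyE p) coef_sum !raddf_sum /=.
apply: eq_bigr => m' _; rewrite coefZ coefXn mcoeffZ mcoeffX.
have -> : (m' == mnm_rcons m i) =
  ([multinom m' (W j) | j < n] == m) && (i == m' ord_max).
  apply/eqP/andP => [->|[/eqP <- /eqP ->]].
    rewrite mnm_rcons_max; split=> //; apply/eqP/mnmP => j.
    by rewrite mnmE mnm_rcons_widen.
  apply/mnmP => j; have [->|[k ->]] := ord_max_or_widen j; first by rewrite mnm_rcons_max.
  by rewrite mnm_rcons_widen mnmE.
case: (i == _); rewrite ?andbT ?andbF ?mulr0 ?mulr1 ?mcoeff0 //.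
by rewrite mcoeffZ mcoeffX.
Qed.

Lemma muni_surj (q : {poly {mpoly K[n]}}) : exists p, muni p = q.
Proof.
elim/poly_ind: q => [|q c [p <-]]; first by exists 0; rewrite raddf0.
have muniX : muni ('X_ord_max : {mpoly K[n.+1]}) = 'X.
  apply/polyP => i; apply/mpolyP => m; rewrite mcoeff_muni mcoeffX coefX.
  have -> : (U_(ord_max)%MM == mnm_rcons m i) = (m == 0%MM) && (i == 1)%N.
    apply/eqP/andP => [def_m|[/eqP -> /eqP ->]].
      rewrite -(mnm_rcons_max m i) -def_m mnm1E eqxx; split=> //.
      apply/eqP/mnmP => j; rewrite mnm0E -(mnm_rcons_widen m i) -def_m mnm1E.
      by rewrite eq_sym widen_neq_max.
    apply/mnmP => j; rewrite mnm1E; have [->|[k ->]] := ord_max_or_widen j.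
      by rewrite eqxx mnm_rcons_max.
    by rewrite mnm_rcons_widen mnm0E eq_sym widen_neq_max.
  by case: (i == 1)%N; rewrite ?andbT ?andbF ?mcoeff0 ?mcoeff1.
have [p' def_c] : exists p', muni p' = c%:P.
  exists (mwiden c); apply/polyP => i; apply/mpolyP => m.
  rewrite mcoeff_muni coefC; case: i => [|i] /=.
    by rewrite -(mwiden_mnmwiden c).
  rewrite mcoeff0 (mwidenE (leqnn _)) raddf_sum /= big1 // => m' _.
  rewrite mcoeffZ mcoeffX; case: eqP => [|_]; last by rewrite mulr0.
  by move/mnmP/(_ ord_max); rewrite mnmwiden_ordmax mnm_rcons_max.
by exists (p * 'X_ord_max + p'); rewrite rmorphD rmorphM /= muniX def_c.
Qed.

Lemma muni_complete_sym j :
  muni (complete_sym j.+1 : {mpoly K[n.+1]}) = 'X * muni (complete_sym j) + (complete_sym j.+1)%:P.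
Proof.
apply/polyP => i; apply/mpolyP => m.
rewrite mcoeff_muni coefD coefXM coefC mcoeffD mcoeff_complete_sym mdeg_rcons.
case: i => [|i] /=; rewrite mcoeff0 ?add0r ?addr0 ?mcoeff_complete_sym ?addn0 //.
by rewrite mcoeff_muni mcoeff_complete_sym mdeg_rcons addnS eqSS.
Qed.

Definition deletion Delta : {set 'I_n} -> Prop := fun A => Delta (W @: A)%SET.
Definition link Delta : {set 'I_n} -> Prop :=
  fun A => Delta (ord_max |: (W @: A))%SET.

Lemma varset_rcons m i :
  varset (mnm_rcons m i) = if i == 0%N then W @: varset m else ord_max |: (W @: varset m).
Proof.
apply/setP => j; rewrite inE; have [->|[k ->]] := ord_max_or_widen j.
  rewrite mnm_rcons_max; case: (i == 0%N); rewrite ?inE ?eqxx //.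
  exact/esym/negbTE/max_notin_widen.
rewrite mnm_rcons_widen; case: (i == 0%N); rewrite ?inE (mem_imset _ _ widen_inj) inE //.
by rewrite widen_neq_max.
Qed.

Lemma face_ideal_muni Delta :
  face_ideal (K := K) Delta =
  (fun p => xsplit_ideal (face_ideal (deletion Delta)) (face_ideal (link Delta)) (muni p)).
Proof.
apply/predeqP => p; split=> [pD|[p0 p1] m].
  by split=> [|i] m Dm; rewrite mcoeff_muni; apply: pD; rewrite varset_rcons.
have [m' [[|i] ->]] := mnm_rconsP m; rewrite varset_rcons -mcoeff_muni; first exact: p0.
exact: p1.
Qed.

Lemma deletion_down Delta : down_closed Delta -> down_closed (deletion Delta).
Proof. by move=> dD A B sAB; apply: dD; apply: imsetS. Qed.

Lemma link_down Delta : down_closed Delta -> down_closed (link Delta).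
Proof. by move=> dD A B sAB; apply: dD; apply: setUS; apply: imsetS. Qed.

End LastVariable.

(** By induction on the number of variables. The faces are confined to a set
    [F] of vertices so that simplices are covered as well as skeleta on all
    the vertices; the degrees of the sequence start at an arbitrary [s.+1]
    since passing to the link drops the first element. *)
Lemma regular_rec_complete_sym_skeleton (K : fieldType) n (Delta : {set 'I_n} -> Prop)
    (F : {set 'I_n}) d s :
  down_closed Delta -> (forall B : {set 'I_n}, Delta B -> B \subset F) ->
  (forall B : {set 'I_n}, B \subset F -> (#|B| <= d)%N -> Delta B) -> (d <= #|F|)%N ->
  regular_rec (face_ideal (K := K) Delta) [seq complete_sym j | j <- iota s.+1 d].
Proof.
elim: n Delta F d s => [|n IH] Delta F [|c] s // downD subF skelF le_dF.
  by have := leq_trans le_dF (max_card F); rewrite card_ord.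
set W := widen_ord (leqnSn n); have injW : injective W := @widen_inj n.
pose F' := (W @^-1: F)%SET.
have subW (A : {set 'I_n}) : (W @: A \subset F)%SET = (A \subset F') by rewrite sub_imset_pre.
have card_F : #|F| = ((ord_max \in F) + #|F'|)%N.
  rewrite -(card_imset _ injW) (cardsD1 ord_max F); congr (_ + _)%N; apply: eq_card => i.
  rewrite !inE; have [->|[j ->]] := ord_max_or_widen i.
    rewrite eqxx; exact/esym/negbTE/max_notin_widen.
  by rewrite mem_imset // inE widen_neq_max.
have maxW := @max_notin_widen n.
rewrite face_ideal_muni; apply: regular_rec_preim; first exact: muni_surj.
rewrite -map_comp; set f := (X in map X _).
have f0 : f 0%N = 1 by rewrite /f /= complete_sym0 rmorph1.
have fS j : f j.+1 = 'X * f j + (complete_sym j.+1)%:P by rewrite /f /= muni_complete_sym.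
have id0 := @face_ideal_ideal _ K _ (deletion_down downD).
have id1 := @face_ideal_ideal _ K _ (link_down downD).
have sub_del B : deletion Delta B -> B \subset F' by move/subF; rewrite subW.
have skel_del (B : {set 'I_n}) : B \subset F' -> (#|B| <= c.+1)%N -> deletion Delta B.
  by move=> sBF le_B; apply: skelF; rewrite ?subW // card_imset.
have rs1 : regular_rec (face_ideal (K := K) (link Delta)) [seq complete_sym j | j <- iota s.+2 c].
  case F_max: (ord_max \in F); last first.
    apply: regular_rec_unit_ideal => // m /subF; rewrite subUset sub1set F_max //.
  apply: (IH _ F') => [|B|B sBF le_B|]; first exact: link_down.
  - by move/subF; rewrite subUset subW => /andP[].
  - apply: skelF; first by rewrite subUset sub1set F_max subW.
    by rewrite cardsU1 maxW card_imset.
  - by move: le_dF; rewrite card_F F_max.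
  (* When [F'] has too few vertices for the deletion to satisfy the size
     condition, all subsets of [F'] are faces and the complex is a cone. *)
have [le_dF'|lt_F'd] := leqP c.+1 #|F'|.
  apply: (regular_rec_link_del f0 fS id0 id1 _ rs1).
    by move=> p p0 m lm; apply: p0; apply: downD lm; rewrite subsetUr.
  exact: (IH _ F' c.+1 s (deletion_down downD)).
have F_max : ord_max \in F.
  by move: le_dF; rewrite card_F; case: (_ \in _); rewrite // leqNgt lt_F'd.
have -> : deletion Delta = link Delta.
  apply/funext => B; apply/propext; split=> [DB|]; last by apply: downD; rewrite subsetUr.
  have sBF := sub_del _ DB.
  apply: skelF; first by rewrite subUset sub1set F_max subW.
  rewrite cardsU1 maxW card_imset // ltnS -ltnS.
  exact: leq_ltn_trans (subset_leq_card sBF) lt_F'd.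
by rewrite -poly_ideal_E; exact: (regular_rec_cone f0 fS id1 rs1).
Qed.

(** * Koszul cohomology bounds regular sequences *)

Section Koszul.
Variables (R : comNzRingType) (n : nat) (y : 'I_n -> R).
Implicit Types (I : set R) (z w : {set 'I_n} -> R) (T : {set 'I_n}).

(** The sign of [i] in the wedge product over [T], with [T] in increasing
    order. *)
Definition koszul_sign (i : 'I_n) T : R := (-1) ^+ #|[set j in T | (j < i)%N]|.

Lemma koszul_signU1 i j T : j \notin T ->
  koszul_sign i (j |: T) = (-1) ^+ (j < i)%N * koszul_sign i T.
Proof.
move=> jT; rewrite /koszul_sign -exprD; congr (_ ^+ _).
rewrite (cardsD1 j) !inE eqxx /=; congr (_ + _)%N; apply: eq_card => k.
by rewrite !inE; case: (eqVneq k j) => // ->; rewrite (negbTE jT).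
Qed.

Lemma koszul_signD1 i j T : j \in T ->
  koszul_sign i (T :\ j) = (-1) ^+ (j < i)%N * koszul_sign i T.
Proof.
move=> jT; rewrite -[T in RHS](setD1K jT) koszul_signU1 ?signrMK // !inE eqxx //.
Qed.

Lemma koszul_sign_sq i T : koszul_sign i T * koszul_sign i T = 1.
Proof. by rewrite -expr2 sqrr_sign. Qed.

Lemma koszul_sign_swap i j : i != j :> 'I_n -> (-1) ^+ (j < i)%N = - (-1) ^+ (i < j)%N :> R.
Proof. by rewrite -val_eqE /=; case: ltngtP; rewrite ?expr0 ?expr1 ?opprK. Qed.

Definition koszul_diff z : {set 'I_n} -> R :=
  fun T => \sum_(i in T) koszul_sign i T * y i * z (T :\ i).

Lemma koszul_diffD z w T : koszul_diff (fun T => z T + w T) T = koszul_diff z T + koszul_diff w T.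
Proof. by rewrite -big_split; apply: eq_bigr => i _; rewrite mulrDr. Qed.

Lemma koszul_diffZ a z T : koszul_diff (fun T => a * z T) T = a * koszul_diff z T.
Proof. by rewrite mulr_sumr; apply: eq_bigr => i _; rewrite mulrCA. Qed.

(** The terms for [(i, j)] and [(j, i)] cancel. They are matched through the
    two halves [i < j] and [j < i] of the double sum, as antisymmetry alone
    would not suffice in characteristic two. *)
Lemma koszul_diff_diff z T : koszul_diff (koszul_diff z) T = 0.
Proof.
(* The summand, written so that only its first sign depends on the order. *)
pose G (i j : 'I_n) :=
  (-1) ^+ (i < j)%N * koszul_sign i T * koszul_sign j T * y i * y j * z (T :\ i :\ j).
transitivity (\sum_(i in T) \sum_(j in T | j != i) G i j).
  apply: eq_bigr => i iT; rewrite mulr_sumr.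
  apply: eq_big => [j|j]; rewrite !inE ?[(j != i) && _]andbC // => /andP[ne_ji jT].
  by rewrite koszul_signD1 // /G; ring.
have Gswap i j : i != j -> G j i = - G i j.
  move=> ne_ij; rewrite /G koszul_sign_swap //.
  have -> : T :\ j :\ i = T :\ i :\ j by apply/setP => k; rewrite !inE andbCA.
  ring.
transitivity (\sum_(i in T) \sum_(j in T | (i < j)%N) G i j
              + \sum_(i in T) \sum_(j in T | (j < i)%N) G i j).
  rewrite -big_split; apply: eq_bigr => i _ /=.
  rewrite (bigID (fun j : 'I_n => (i < j)%N)) /=; congr (_ + _).
    by apply: eq_bigl => j; rewrite -val_eqE -andbA /=; case: ltngtP; rewrite ?andbF ?andbT.
  by apply: eq_bigl => j; rewrite -val_eqE -andbA /=; case: ltngtP; rewrite ?andbF ?andbT.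
have -> : \sum_(i in T) \sum_(j in T | (j < i)%N) G i j
        = \sum_(i in T) \sum_(j in T | (i < j)%N) G j i.
  rewrite (exchange_big_dep (mem T)) => [|i j _ /andP[]] //=.
  apply: eq_bigr => j jT; apply: eq_bigl => i; by rewrite jT.
rewrite -big_split big1 // => i _; rewrite -big_split big1 // => j /andP[_ lt_ij].
have ne_ij : i != j by rewrite -val_eqE /= ltn_eqF.
by rewrite /= (Gswap _ _ ne_ij) subrr.
Qed.

Definition contract i z : {set 'I_n} -> R :=
  fun T => if i \in T then 0 else koszul_sign i T * z (i |: T).

(** Contraction against the [i]-th basis vector is a homotopy from zero to
    multiplication by [y i], which therefore acts as zero on cohomology. *)
Lemma koszul_homotopy i z T :
  koszul_diff (contract i z) T + contract i (koszul_diff z) T = y i * z T.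
Proof.
rewrite {2}/contract; case: ifPn => iT.
  rewrite addr0 /koszul_diff (bigD1 i) //= big1 ?addr0 => [|j /andP[jT ne_ji]]; last first.
    by rewrite /contract !inE eq_sym ne_ji iT mulr0.
  rewrite /contract !inE eqxx /= setD1K // koszul_signD1 // ltnn expr0 mul1r.
  by rewrite mulrACA koszul_sign_sq mul1r.
rewrite [koszul_diff z _]/koszul_diff (bigD1 i) ?setU11 //= setU1K // koszul_signU1 //.
rewrite ltnn expr0 mul1r.
rewrite mulrDr !mulrA koszul_sign_sq mul1r addrCA -[RHS]addr0; congr (_ + _).
apply/eqP; rewrite addr_eq0; apply/eqP; rewrite mulr_sumr -sumrN.
apply: eq_big => [j|j jT].
  by rewrite !inE; case: (eqVneq j i) => [->|_]; rewrite ?(negbTE iT) ?andbT.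
have ne_ij : i != j by apply: contraNneq iT => ->.
rewrite /contract !inE (negbTE iT) andbF koszul_signD1 // koszul_signU1 // (koszul_sign_swap ne_ij).
have -> : (i |: T) :\ j = i |: T :\ j.
  by apply/setP => k; rewrite !inE; case: (eqVneq k i) => // ->; rewrite ne_ij.
ring.
Qed.

(** Cochains have coefficients in [R / I], and only their values on sets of
    size [d] matter in degree [d]. *)
Definition cocycle I d z := forall T, #|T| = d.+1 -> I (koszul_diff z T).
Definition coboundary I d z := exists w, forall T, #|T| = d -> I (z T - koszul_diff w T).
Definition koszul_nonzero I d := exists2 z, cocycle I d z & ~ coboundary I d z.

(** The multipliers that kill the class of [z] form an ideal, so it is enough
    to know some of its elements. *)
Lemma coboundary_annihilator_ideal I d z : is_ideal I ->
  is_ideal (fun a => coboundary I d (fun T => a * z T)).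
Proof.
move=> idI; have [I0 ID IM] := idI; split.
- exists (fun=> 0) => T _; rewrite mul0r sub0r.
  by apply: idealN => //; apply: ideal_sum => // i _; rewrite mulr0.
- move=> a b [w waI] [v vbI]; exists (fun T => w T + v T) => T cT.
  by rewrite koszul_diffD mulrDl opprD addrACA; apply: ID; auto.
- move=> a b [w wbI]; exists (fun T => a * w T) => T cT.
  by rewrite koszul_diffZ -mulrA -mulrBr; apply: IM; auto.
Qed.

Lemma koszul_annihilated I d z i : is_ideal I -> cocycle I d z ->
  coboundary I d (fun T => y i * z T).
Proof.
move=> idI zI; exists (contract i z) => T cT.
rewrite -koszul_homotopy addrAC subrr add0r /contract; have [I0 _ IM] := idI.
by case: ifPn => // iT; apply/IM/zI; rewrite cardsU1 iT cT.
Qed.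

Definition radical I : set R := fun f => exists N, I (f ^+ N).

(** Some power of [f] kills the class of [z]; the last power that does not
    kill it gives a nonzero class killed by [f]. *)
Lemma koszul_socle I d f : is_ideal I -> radical (ideal_gen (range y)) f ->
  koszul_nonzero I d ->
  exists z, [/\ cocycle I d z, ~ coboundary I d z & coboundary I d (fun T => f * z T)].
Proof.
move=> idI [N fNy] [z zI zB].
have := fNy; move/(ideal_gen_min (coboundary_annihilator_ideal d z idI)) => fNB.
have {fNB} : coboundary I d (fun T => f ^+ N * z T).
  by apply: fNB => _ [i _ <-]; apply: koszul_annihilated.
elim: N {fNy} => [|N IH] fNB.
  case: zB; case: fNB => w wI; exists w => T /wI; by rewrite mul1r.
have [/IH //|nB] := EM (coboundary I d (fun T => f ^+ N * z T)).
exists (fun T => f ^+ N * z T); split=> //.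
  move=> T cT; rewrite koszul_diffZ; case: idI => _ _ IM; apply: IM; exact: zI.
by case: fNB => w wI; exists w => T /wI; rewrite mulrA -exprS.
Qed.

(** If [f] kills the class of [z], then [f z] is the coboundary of some [w],
    which becomes a cocycle modulo [f]. If [w] were a coboundary modulo [f],
    then [f z] would be [f] times a coboundary, and [z] itself a coboundary as
    [f] is regular. In degree zero there are no coboundaries, and [f z = 0]
    contradicts regularity. *)
Lemma koszul_descent I d f : is_ideal I -> radical (ideal_gen (range y)) f ->
  regular_mod I f -> koszul_nonzero I d ->
  exists2 d', d = d'.+1 & koszul_nonzero (adjoin I f) d'.
Proof.
move=> idI frad freg /(koszul_socle idI frad)[z [zI zB [w wI]]].
case: d => [|d] in zI zB wI *.
  case: zB; exists w => T cT; have := wI T cT.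
  by move: cT => /eqP; rewrite cards_eq0 => /eqP ->; rewrite /koszul_diff big_set0 !subr0 => /freg.
exists d => //; exists w.
  move=> T cT; exists (- (f * z T - koszul_diff w T)); first by apply: idealN; auto.
  by exists (z T); ring.
case=> u uI; apply: zB.
have /choice[v vP] : forall T, exists b, #|T| = d -> I (w T - koszul_diff u T - b * f).
  move=> T; have [cT|ncT] := EM (#|T| = d); last by exists 0.
  by have [a Ia [b ->]] := uI T cT; exists b; rewrite addrK.
exists v => T cT; apply: freg.
rewrite mulrBr -koszul_diffZ.
have -> : f * z T - koszul_diff (fun T => f * v T) T =
   (f * z T - koszul_diff w T) + koszul_diff (fun T => w T - koszul_diff u T - v T * f) T.
  have -> : koszul_diff (fun T => w T - koszul_diff u T - v T * f) T =
            koszul_diff w T - koszul_diff (koszul_diff u) T - koszul_diff (fun T => f * v T) T.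
    rewrite /koszul_diff -!sumrB; apply: eq_bigr => i _; ring.
  by rewrite koszul_diff_diff; ring.
case: (idI) => _ ID IM; apply: ID; first exact: wI.
apply: ideal_sum => // i iT; apply: IM; apply: vP.
by move: cT; rewrite (cardsD1 i) iT => -[].
Qed.

Lemma koszul_bound I d s : is_ideal I -> koszul_nonzero I d -> regular_rec I s ->
  (forall f, f \in s -> radical (ideal_gen (range y)) f) -> (size s <= d)%N.
Proof.
elim: s I d => // f s IH I d idI nzd [regf rs] sy /=.
have [d' -> nzd'] := koszul_descent idI (sy f (mem_head f s)) regf nzd.
rewrite ltnS; apply: IH nzd' rs _; first exact: adjoin_ideal.
by move=> g gs; apply: sy; rewrite inE gs orbT.
Qed.

End Koszul.

Lemma radical_ideal (R : comNzRingType) (I : set R) : is_ideal I -> is_ideal (radical I).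
Proof.
move=> idI; have [I0 ID IM] := idI; split.
- by exists 1%N.
- move=> a b [N aN] [M bM]; exists (N + M)%N; rewrite exprDn.
  apply: ideal_sum => // i _; rewrite -mulr_natl; apply: (IM).
  have [le_Mi|lt_iM] := leqP M i.
    by apply: (IM); rewrite -(subnK le_Mi) exprD; apply: (IM).
  apply: ideal_mulr => //.
  have le_N : (N <= N + M - i)%N by rewrite -addnBA ?leq_addr // ltnW.
  by rewrite -(subnK le_N) exprD; apply: IM.
- by move=> a b [N bN]; exists N; rewrite exprMn; apply: IM.
Qed.

(** * The Koszul class of a disconnected link *)

Section DisconnectedLink.
Variables (n : nat) (K : fieldType).
Local Notation S := {mpoly K[n]}.

Lemma irrelevant_radical (f : S) : irrelevant_ideal f ->
  radical (ideal_gen (range (fun i : 'I_n => 'X_i ^+ 2 : S))) f.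
Proof.
apply: ideal_gen_min; first exact/radical_ideal/ideal_gen_ideal.
by move=> _ [i ->]; exists 2%N; apply: mem_ideal_gen; exists i.
Qed.

Lemma mcoeff_koszul_sign i (T : {set 'I_n}) (p : S) m :
  (koszul_sign S i T * p)@_m = koszul_sign K i T * p@_m.
Proof.
rewrite /koszul_sign -signr_odd -[in RHS]signr_odd; case: (odd _).
  by rewrite !expr1 !mulN1r mcoeffN.
by rewrite !expr0 !mul1r.
Qed.

(** The vertices of the link of [F] fall into those in [U] and those outside,
    with no edge between them. The indicator function of [U] is then a cocycle
    of degree [0] of the link, but not a constant. In the Koszul complex of
    the squares [x_i ^ 2], the part of multidegree minus the indicator of [F]
    is the cochain complex of the link shifted by [#|F|.+1]: there the
    constant function on the link is the coboundary of [w0], concentrated on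
    [F], and the class sought is the restriction of this coboundary to [U]. *)
Lemma disconnected_link_koszul (Delta : {set 'I_n} -> Prop) (F U : {set 'I_n}) :
  down_closed Delta -> (forall u, u \notin F -> Delta (u |: F)) ->
  (forall u w, u \notin F -> w \notin F -> u \in U -> w \notin U ->
     ~ Delta (u |: (w |: F))) ->
  (exists2 u, u \notin F & u \in U) -> (exists2 w, w \notin F & w \notin U) ->
  koszul_nonzero (fun i => 'X_i ^+ 2 : S) (face_ideal Delta) #|F|.+1.
Proof.
set y := (fun i : 'I_n => 'X_i ^+ 2 : S) => downD faceF nonface [u uF uU] [w' wF wU].
pose mF : 'X_{1..n} := [multinom (i \in F : nat) | i < n].
pose w0 (T : {set 'I_n}) : S := if T == F then 'X_[mF] else 0.
(* Restricting the coboundary of [w0] to the sets that meet [U] off [F]. *)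
pose meets T := (T :\: F) :&: U != set0.
pose z T := if meets T then koszul_diff y w0 T else 0.
have yX i : y i = 'X_[U_(i) *+ 2] by rewrite /y mpolyXn.
have coef_y i (p : S) (m : 'X_{1..n}) : (m i < 2)%N -> (y i * p)@_m = 0.
  move=> lt_m2; rewrite yX mcoeffM big1 // => -[m1 m2] /= /eqP def_m.
  rewrite mcoeffX; case: eqP => [def_m1|]; last by rewrite mul0r.
  have def_mi : m i = (m1 i + m2 i)%N by rewrite -mnmDE -def_m.
  have := lt_m2; rewrite def_mi -def_m1 mulmnE mnm1E eqxx mul1n.
  by rewrite ltnNge leq_addr.
(* For [v] outside [F], the monomial [x_v ^ 2 * x_F] detects the coefficient
   of [x_F] in [w F]: the other terms have some [x_i ^ 2] with [i] in [F]. *)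
have coef_bd w v : v \notin F ->
    (koszul_diff y w (v |: F))@_(U_(v) *+ 2 + mF)%MM = koszul_sign K v (v |: F) * (w F)@_mF.
  move=> vF; rewrite /koszul_diff raddf_sum (bigD1 v) ?setU11 //= big1 ?addr0 => [|i].
    rewrite -mulrA mcoeff_koszul_sign setU1K // yX [_ * w F]mulrC.
    by rewrite mcoeffMX.
  rewrite !inE => /andP[/predU1P[->|iF] ne_iv]; first by rewrite eqxx in ne_iv.
  rewrite -mulrA mcoeff_koszul_sign coef_y ?mulr0 //.
  by rewrite mnmDE mulmnE mnm1E eq_sym (negbTE ne_iv) mul0n mnmE iF.
have bd_w0 (T : {set 'I_n}) : ~~ (F \subset T) -> koszul_diff y w0 T = 0.
  move=> nFT; rewrite /koszul_diff big1 // => i iT; rewrite /w0.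
  case: eqP => [def_F|]; last by rewrite mulr0.
  by rewrite -def_F subD1set in nFT.
have varset_v v : varset (U_(v) *+ 2 + mF)%MM = v |: F.
  apply/setP => i; rewrite !inE mnmDE mulmnE mnm1E mnmE (eq_sym i v).
  by case: (v == i); case: (i \in F).
(* If [z] were the coboundary of [w], the coefficient of [x_F] in [w F] would
   be 1 according to the vertices in [U], and 0 according to the others. *)
exists z; last first.
  case=> w wI.
  have coef_w v : v \notin F -> (w F)@_mF = (v \in U)%:R.
    move=> vF; have := wI (v |: F); rewrite cardsU1 vF => /(_ erefl (U_(v) *+ 2 + mF)%MM).
    rewrite varset_v => /(_ (faceF v vF))/eqP.
    have meetsE : meets (v |: F) = (v \in U).
      rewrite /meets; have -> : (v |: F) :\: F = [set v]%SET.
        by apply/setP => i; rewrite !inE; case: eqVneq => [->|]; rewrite ?vF ?orbF //= ?andNb.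
      apply/set0Pn/idP => [[i]|vU];
        by [rewrite !inE => /andP[/eqP ->] | exists v; rewrite !inE eqxx].
    rewrite mcoeffB subr_eq0 coef_bd // /z meetsE => /eqP eq_w.
    rewrite -[LHS]mul1r -(koszul_sign_sq K v (v |: F)) -mulrA -eq_w.
    case: (v \in U); last by rewrite mcoeff0 mulr0.
    by rewrite coef_bd // mulrA koszul_sign_sq mul1r /w0 eqxx mcoeffX eqxx.
  have := coef_w _ wF; rewrite (coef_w _ uF) uU (negbTE wU) => /eqP.
  by rewrite oner_eq0.
have idD := @face_ideal_ideal _ K _ downD; have [J0 _ JM] := idD.
move=> T cT.
have nonface_bd : ~ Delta T -> face_ideal Delta (koszul_diff y z T).
  move=> nDT; apply: ideal_sum => // j jT; rewrite -mulrA; apply: (JM).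
  rewrite /z; case: (meets _); last by rewrite mulr0.
  rewrite mulr_sumr; apply: ideal_sum => // i iT.
  rewrite -mulrA mulrCA; apply: (JM); rewrite /w0.
  case: eqP => [def_F|_]; last by rewrite !mulr0.
  rewrite !yX -!mpolyXD => m; rewrite mcoeffX; case: eqP => // <-.
  have -> // : varset (U_(j) *+ 2 + (U_(i) *+ 2 + mF))%MM = T.
  rewrite varsetD varset_v -def_F -(setD1K jT) -(setD1K iT).
  apply/setP => k.
  by rewrite !inE mulmnE mnm1E (eq_sym j k); case: (k == j); case: (k == i).
have [FT|nFT] := boolP (F \subset T); last first.
  rewrite /koszul_diff big1 // => i iT; rewrite /z bd_w0 ?if_same ?mulr0 //.
  by apply: contra nFT => /subset_trans -> //; apply: subD1set.
have /eqP/cards2P[a [b [ne_ab def_ab]]] : #|T :\: F| = 2.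
  by have := cardsID F T; rewrite (setIidPr FT) cT -addn2 => /addnI.
have [aF aT] : a \notin F /\ a \in T by apply/andP; have := set21 a b; rewrite -def_ab inE.
have [bF bT] : b \notin F /\ b \in T by apply/andP; have := set22 a b; rewrite -def_ab inE.
have def_T : T = a |: (b |: F) by rewrite -(setID T F) (setIidPr FT) def_ab setUC setUA.
have meetsT j : meets (T :\ j) = ((a \in U) && (a != j)) || ((b \in U) && (b != j)).
  rewrite /meets; have -> : (T :\ j) :\: F = [set a; b]%SET :\ j.
    by rewrite -def_ab; apply/setP => i; rewrite !inE andbCA.
  apply/set0Pn/orP => [[i]|].
    rewrite !inE => /andP[/andP[ne_ij /orP[]/eqP def_i] iU]; [left|right];
    by rewrite -def_i iU.
  by case=> /andP[iU ne_ij]; [exists a | exists b]; rewrite !inE iU ne_ij eqxx ?orbT.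
(* Two vertices in [U]: [z] coincides with the coboundary of [w0] around [T].
   Two vertices outside [U]: [z] vanishes there.  One of each: [T] is not a
   face, and every term lies in the face ideal. *)
case aU: (a \in U); case bU: (b \in U).
- have -> : koszul_diff y z T = koszul_diff y (koszul_diff y w0) T.
    apply: eq_bigr => j _; rewrite /z meetsT aU bU /= -negb_and.
    by case: eqVneq => // <-; rewrite eq_sym ne_ab.
  by rewrite koszul_diff_diff.
- by have := nonface a b aF bF aU; rewrite bU -def_T => /(_ isT); exact: nonface_bd.
- have := nonface b a bF aF bU; rewrite aU setUCA -def_T => /(_ isT); exact: nonface_bd.
- by rewrite /koszul_diff big1 // => j _; rewrite /z meetsT aU bU mulr0.
Qed.
End DisconnectedLink.

(** * Connected complexes *)

Section Gluing.
Variables (n : nat) (K : fieldType).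
Local Notation S := {mpoly K[n]}.
Implicit Types (F G : {set 'I_n}) (p q : S).

Definition simplex F : {set 'I_n} -> Prop := fun G => G \subset F.

Lemma simplex_down F : down_closed (simplex F).
Proof. by move=> A B; apply: subset_trans. Qed.

Lemma simplex_ideal F : is_ideal (face_ideal (K := K) (simplex F)).
Proof. exact/face_ideal_ideal/simplex_down. Qed.

Lemma regular_rec_complete_sym_simplex F d : (d <= #|F|)%N ->
  regular_rec (face_ideal (K := K) (simplex F)) [seq complete_sym j | j <- iota 1 d].
Proof. by apply: regular_rec_complete_sym_skeleton => //; apply: simplex_down. Qed.

Definition exact_part F p : S := \sum_(m <- msupp p | varset m == F) p@_m *: 'X_[m].

Lemma mcoeff_exact_part F p m :
  (exact_part F p)@_m = if varset m == F then p@_m else 0.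
Proof.
rewrite raddf_sum /=; case: ifPn => [mF|nmF]; last first.
  rewrite big1 // => m' m'F; rewrite mcoeffZ mcoeffX.
  by case: eqP => [def_m|]; [rewrite -def_m m'F in nmF | rewrite mulr0].
rewrite [in RHS](mpolyE p) raddf_sum /= big_mkcond.
apply: eq_bigr => m' _; case: ifPn => // m'F; rewrite mcoeffZ mcoeffX.
by case: eqP => [def_m|]; [rewrite def_m mF in m'F | rewrite mulr0].
Qed.

Lemma varset_eq0 (m : 'X_{1..n}) : (varset m == set0) = (m == 0%MM).
Proof.
apply/eqP/eqP => [m0|->]; last by apply/setP => i; rewrite !inE mnm0E.
by apply/mnmP => i; move/setP/(_ i): m0; rewrite !inE mnm0E => /negbT; rewrite negbK => /eqP.
Qed.

Lemma varset0 : varset (0%MM : 'X_{1..n}) = set0.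
Proof. by apply/eqP; rewrite varset_eq0. Qed.

(** Prescribing the monomials face by face always defines a polynomial, since
    there are finitely many faces; the constant term has to be given
    separately, as no nonempty face carries it exactly. *)
Lemma glue_faces (q : {set 'I_n} -> S) (c : K) :
  exists Q : S, forall m, Q@_m = if varset m == set0 then c else (q (varset m))@_m.
Proof.
exists (c%:MP + \sum_(F | F != set0) exact_part F (q F)) => m.
rewrite mcoeffD mcoeffC raddf_sum /= -varset_eq0; have [m0|nz] := eqVneq (varset m) set0.
  rewrite mulr1 big1 ?addr0 // => F nF; rewrite mcoeff_exact_part.
  by rewrite m0 eq_sym (negbTE nF).
rewrite mulr0 add0r (bigD1 (varset m)) //= mcoeff_exact_part eqxx big1 ?addr0 // => F /andP[_ nF].
by rewrite mcoeff_exact_part eq_sym (negbTE nF).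
Qed.

(** Gluing of the quotients by [h_1] found on the faces. Connectedness enters
    twice: it makes their constant terms equal, and it puts each vertex on an
    edge, where [h_1, h_2] is regular. *)
Lemma regular_rec_complete_sym_connected (Delta : {set 'I_n} -> Prop) (r : rel 'I_n) :
  (1 < n)%N -> down_closed Delta -> (forall i, Delta [set i]%SET) ->
  (forall i j, r i j -> i != j /\ Delta [set i; j]%SET) -> (forall i j, connect r i j) ->
  regular_rec (face_ideal (K := K) Delta) [:: complete_sym 1; complete_sym 2].
Proof.
move=> n_gt1 downD vertD edgeD conn.
have [o _] : exists o : 'I_n, true by exists (Ordinal (ltnW n_gt1)).
have subD F p : Delta F -> face_ideal Delta p -> face_ideal (simplex F) p.
  by move=> DF pD m sm; apply: pD; apply: downD DF.
have h1_reg F : F != set0 -> regular_mod (face_ideal (K := K) (simplex F)) (complete_sym 1).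
  by rewrite -card_gt0 => /regular_rec_complete_sym_simplex[].
have reg1 : regular_mod (face_ideal (K := K) Delta) (complete_sym 1).
  suff [] : regular_rec (face_ideal (K := K) Delta) [seq complete_sym j | j <- iota 1 1] by [].
  apply: (@regular_rec_complete_sym_skeleton K n Delta setT 1 0) => // [B _ cB|]; last first.
    by rewrite cardsT card_ord ltnW.
  have [->|[i iB]] := set_0Vmem B; first by apply: downD (vertD o); apply: sub0set.
  suff -> : B = [set i]%SET by [].
  by apply/esym/eqP; rewrite eqEcard sub1set iB cards1.
split=> //; split=> // g Ig; case: Ig => a aD [b eq_h2g].
(* The quotient of [g] by [h_1] on a nonempty face [F]; a vertex inherits it
   from an edge. *)
have quotF F : Delta F -> F != set0 ->
    exists q, face_ideal (K := K) (simplex F) (g - q * complete_sym 1).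
  have big_case G : Delta G -> (1 < #|G|)%N ->
      exists q, face_ideal (K := K) (simplex G) (g - q * complete_sym 1).
    move=> DG /regular_rec_complete_sym_simplex[_ [reg2 _]].
    have [a' a'G [q ->]] : adjoin (face_ideal (K := K) (simplex G)) (complete_sym 1) g.
      by apply: reg2; rewrite eq_h2g; exists a; [apply: subD DG aD | exists b].
    by exists q; rewrite addrK.
  move=> DF F0; have [|le_F1] := ltnP 1 #|F|; first exact: big_case.
  have [i def_F] : exists i, F = [set i]%SET.
    by apply/cards1P; rewrite eqn_leq le_F1 card_gt0.
  have [j r_ij] : exists j, r i j.
    have [k ne_ki] : exists k, k != i.
      have : (0 < #|[set~ i]|)%N by rewrite cardsC1 card_ord -subn1 subn_gt0.
      by rewrite card_gt0 => /set0Pn[k]; rewrite !inE => ?; exists k.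
    have /connectP[[|j s] /= path_s def_k] := conn i k; first by rewrite def_k eqxx in ne_ki.
    by exists j; case/andP: path_s.
  have [ne_ij Dij] := edgeD _ _ r_ij.
  have [|q qP] := big_case _ Dij; first by rewrite cards2 ne_ij.
  exists q => m; rewrite def_F /simplex => sm; apply: qP; apply: subset_trans sm _.
  by rewrite sub1set set21.
have /choice[q qP] : forall F, exists q, Delta F -> F != set0 ->
    face_ideal (K := K) (simplex F) (g - q * complete_sym 1).
  move=> F; have [[DF F0]|nF] := EM (Delta F /\ F != set0).
    by have [q] := quotF F DF F0; exists q.
  by exists 0 => DF F0; case: nF.
(* On a nonempty face [h_1] is regular, so the quotient there is unique. *)
have compat F G : Delta F -> G \subset F -> G != set0 ->
    forall m, varset m \subset G -> (q G)@_m = (q F)@_m.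
  move=> DF sGF G0 m mG.
  have F0 : F != set0 by apply: contraNneq G0 => F0; rewrite -subset0 -F0.
  have DG := downD _ _ sGF DF.
  apply/eqP; rewrite -subr_eq0 -mcoeffB; apply/eqP.
  apply: (h1_reg _ G0) mG; rewrite mulrC.
  have -> : (q G - q F) * complete_sym 1 = (g - q F * complete_sym 1) - (g - q G * complete_sym 1).
    by ring.
  apply: (idealB (simplex_ideal G) _ (qP _ DG G0)).
  by move=> m' m'G; apply: (qP F) => //; apply: subset_trans sGF.
(* Adjacent vertices have the same constant term, that of their edge. *)
pose c i := (q [set i]%SET)@_0%MM.
have c_const i : c i = c o.
  have step j k : r j k -> c j = c k.
    move=> /edgeD[_ Djk].
    rewrite /c !(compat [set j; k]%SET) ?varset0 ?sub0set ?sub1set ?set21 ?set22 //.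
      by rewrite -card_gt0 cards1.
    by rewrite -card_gt0 cards1.
  have /connectP[s] := conn i o; elim: s i => [|j s IH] i /=; first by move=> _ ->.
  by case/andP=> /step -> rs /IH ->.
have [Q QE] := glue_faces q (c o).
have QF F : Delta F -> F != set0 -> face_ideal (simplex F) (Q - q F).
  move=> DF F0 m mF; apply/eqP; rewrite mcoeffB subr_eq0 QE; apply/eqP.
  case: eqVneq => [m0|nm0]; last exact: compat.
  have /set0Pn[i iF] := F0.
  have -> : m = 0%MM by apply/eqP; rewrite -varset_eq0 m0.
  rewrite -(c_const i); apply: compat; rewrite ?sub1set -?card_gt0 ?cards1 ?varset0 ?sub0set //.
exists (g - Q * complete_sym 1); last by exists Q; rewrite subrK.
move=> m Dm.
have gQ F : Delta F -> F != set0 -> face_ideal (simplex F) (g - Q * complete_sym 1).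
  move=> DF F0.
  have -> : g - Q * complete_sym 1 = (g - q F * complete_sym 1) - (Q - q F) * complete_sym 1.
    by ring.
  have idF := simplex_ideal F.
  exact: (idealB idF (qP _ DF F0) (ideal_mulr _ idF (QF _ DF F0))).
have [m0|nm0] := eqVneq (varset m) set0; last exact: (gQ _ Dm nm0 m (subxx _)).
by apply: (gQ _ (vertD o)); [rewrite -card_gt0 cards1 | rewrite /simplex m0 sub0set].
Qed.
End Gluing.

(** * Depth of face rings *)

Section FaceRingDepth.
Variables (n : nat) (K : fieldType).
Local Notation S := {mpoly K[n]}.

Lemma mem_irrelevant (p : S) : irrelevant_ideal p <-> p@_0%MM = 0.
Proof.
have idI := ideal_gen_ideal [set p : S | exists i, p = 'X_i]%classic.
split.
  have <- : face_ideal (simplex set0) p = (p@_0%MM = 0).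
    apply/propext; split=> [|p0 m]; first by apply; rewrite varset0 /simplex sub0set.
    by rewrite /simplex subset0 varset_eq0 => /eqP ->.
  apply: ideal_gen_min => [|_ [i ->] m]; first exact: simplex_ideal.
  rewrite /simplex subset0 varset_eq0 => /eqP ->; rewrite mcoeffX; case: eqP => //.
  by move/mnmP/(_ i); rewrite mnm1E eqxx mnm0E.
move=> p0; rewrite [p]mpolyE big_seq; apply: ideal_sum => // m.
rewrite mcoeff_msupp => pm; have : varset m != set0.
  by rewrite varset_eq0; apply: contraNneq pm => ->; rewrite p0.
case/set0Pn=> i; rewrite inE => mi.
have le_im : (U_(i) <= m)%MM by rewrite lep1mP.
rewrite -(submK le_im) mpolyXD scalerAl; case: (idI) => _ _; apply.
by apply: mem_ideal_gen; exists i.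
Qed.

(** The quotient by the sequence is nonzero because both the face ideal and
    the sequence lie in the irrelevant ideal. *)
Lemma regular_length_face (Delta : {set 'I_n} -> Prop) (s : seq S) :
  down_closed Delta -> Delta set0 -> (forall f, f \in s -> f@_0%MM = 0) ->
  regular_rec (face_ideal Delta) s -> regular_length (K := K) (face_ideal Delta) (size s).
Proof.
move=> downD D0 s0 rs; exists s; split=> // [f /s0 /mem_irrelevant //|].
apply/regular_seqE; first exact: face_ideal_ideal.
split=> // J1; have : (1 : S)@_0%MM = 0.
  apply/mem_irrelevant; apply: foldl_adjoin_min J1; first exact: ideal_gen_ideal.
    by move=> a aD; apply/mem_irrelevant; apply: aD; rewrite varset0.
  by move=> f /s0 /mem_irrelevant.
by rewrite mcoeff1 eqxx => /eqP; rewrite oner_eq0.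
Qed.

Lemma complete_sym_constant_term j : (complete_sym j.+1 : S)@_0%MM = 0.
Proof. by rewrite mcoeff_complete_sym mdeg0. Qed.

Lemma regular_length_skeleton (Delta : {set 'I_n} -> Prop) d :
  down_closed Delta -> (forall B : {set 'I_n}, (#|B| <= d)%N -> Delta B) ->
  (d <= n)%N -> regular_length (face_ideal (K := K) Delta) d.
Proof.
move=> downD skelD le_dn.
have -> : d = size [seq (complete_sym j : S) | j <- iota 1 d] by rewrite size_map size_iota.
apply: regular_length_face => //; first by apply: skelD; rewrite cards0.
  by move=> f /mapP[[|j]]; rewrite mem_iota // => _ ->; apply: complete_sym_constant_term.
apply: (@regular_rec_complete_sym_skeleton K n Delta setT) => // [B _|]; first exact: skelD.
by rewrite cardsT card_ord.
Qed.

Lemma depth_eq (J : set S) d : regular_length J d ->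
  (forall d', regular_length J d' -> (d' <= d)%N) -> depth J = d.
Proof.
move=> Jd maxd; have [] : regular_length J (depth J) /\
    forall d', regular_length J d' -> (d' <= depth J)%N.
  by apply: (@xgetPex _ 0%N [set d | regular_length J d /\ _]%classic); exists d.
by move=> /maxd le_d /(_ _ Jd) ge_d; apply/eqP; rewrite eqn_leq le_d.
Qed.

(** A positive value of [depth] cannot be the default one, hence is a true
    maximum. *)
Lemma regular_length_leq_depth (J : set S) d : (0 < depth J)%N ->
  regular_length J d -> (d <= depth J)%N.
Proof.
move=> depth_gt0.
have [exP|nP] := EM (exists d, regular_length J d /\
    forall d', regular_length J d' -> (d' <= d)%N).
  by have [_] := @xgetPex _ 0%N [set d | regular_length J d /\ _]%classic exP; apply.
move: depth_gt0; rewrite /depth xgetPN // => d' Pd'; apply: nP.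
by exists d'.
Qed.

(** The skeleton gives a regular sequence of length [#|F|.+1], and the Koszul
    class of the link of [F] lies in degree [#|F|.+1]. *)
Lemma depth_disconnected_link (Delta : {set 'I_n} -> Prop) (F U : {set 'I_n}) :
  down_closed Delta -> (forall B : {set 'I_n}, (#|B| <= #|F|.+1)%N -> Delta B) ->
  (forall u w, u \notin F -> w \notin F -> u \in U -> w \notin U ->
     ~ Delta (u |: (w |: F))) ->
  (exists2 u, u \notin F & u \in U) -> (exists2 w, w \notin F & w \notin U) ->
  depth (face_ideal (K := K) Delta) = #|F|.+1.
Proof.
move=> downD skelD nonface exU exW; apply: depth_eq.
  apply: regular_length_skeleton => //; have [u uF _] := exU.
  by rewrite -[n in (_ <= n)%N]card_ord; have := max_card (u |: F); rewrite cardsU1 uF.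
move=> _ [s [<- s_irr /(regular_seqE _ (face_ideal_ideal _ downD))[rs _]]].
apply: (koszul_bound _ (disconnected_link_koszul K downD _ nonface exU exW) rs).
- exact: face_ideal_ideal.
- by move=> u uF; apply: skelD; rewrite cardsU1 uF.
- by move=> f /s_irr /irrelevant_radical.
Qed.

End FaceRingDepth.

(** * Matchings across a disconnection of the complement *)

Section Matchings.
Variables (n : nat) (e : rel 'I_n).
Hypothesis e_simple : simple_graph e.
Implicit Types (M N : {set {set 'I_n}}) (D B : {set 'I_n}).

Lemma edgeP D : reflect (exists i j, e i j /\ D = [set i; j]%SET) (D \in edges e).
Proof.
rewrite inE; apply: (iffP existsP) => [[i /existsP[j /andP[eij /eqP ->]]]|[i [j [eij ->]]]].
  by exists i, j.
by exists i; apply/existsP; exists j; rewrite eij eqxx.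
Qed.

Lemma edge_neq i j : e i j -> i != j.
Proof. by apply: contraTneq => ->; case: e_simple => _ ->. Qed.

Lemma card_edge D : D \in edges e -> #|D| = 2.
Proof. by case/edgeP=> i [j [/edge_neq ne_ij ->]]; rewrite cards2 ne_ij. Qed.

Lemma card_matching_cover M : matching e M -> #|finset.cover M| = (2 * #|M|)%N.
Proof.
case/andP=> sM tM; rewrite -(eqP tM) (eq_bigr (fun=> 2)) => [|D DM].
  by rewrite sum_nat_const mulnC.
exact/card_edge/(subsetP sM).
Qed.

Lemma matching_sub M N : N \subset M -> matching e M -> matching e N.
Proof.
by move=> sNM /andP[sM tM]; rewrite /matching (subset_trans sNM sM) (trivIsetS sNM).
Qed.

Lemma matching_remove M D v : matching e M -> D \in M -> v \in D ->
  v \notin finset.cover (M :\ D).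
Proof.
case/andP=> _ /trivIsetP tM DM vD; apply/bigcupP => -[E].
rewrite !inE => /andP[ne_ED EM] vE.
by have /disjoint_setI0/setP/(_ v) := tM _ _ EM DM ne_ED; rewrite !inE vE vD.
Qed.

Lemma matching_add N u w : matching e N -> e u w ->
  u \notin finset.cover N -> w \notin finset.cover N ->
  matching e ([set u; w]%SET |: N) /\ #|[set u; w]%SET |: N| = #|N|.+1.
Proof.
move=> /andP[sN tN] euw uN wN.
have dis : {in N, forall B, [disjoint [set u; w]%SET & B]}.
  move=> B BN; rewrite disjoint_subset; apply/subsetP => v; rewrite !inE.
  by case/orP=> /eqP ->; [apply: contra uN | apply: contra wN] => vB; apply/bigcupP; exists B.
have N0 : set0 \notin N.
  by apply/negP => /(subsetP sN)/card_edge; rewrite cards0.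
have [tN' nN] := trivIsetU1 dis tN N0; split; last by rewrite cardsU1 nN.
rewrite /matching tN' andbT subUset sN andbT sub1set.
by apply/edgeP; exists u, w.
Qed.

Lemma exists_matching k : (k <= matching_number e)%N ->
  exists2 M, matching e M & #|M| = k.
Proof.
move=> le_k.
have [|M matM maxM] := @eq_bigmax_cond _ [pred M | matching e M] (fun M => #|M|).
  apply/card_gt0P; exists set0; rewrite inE /matching sub0set.
  by apply/trivIsetP => A B; rewrite inE.
have {}le_k : (k <= #|M|)%N by rewrite -maxM.
exists [set D in take k (enum M)]%SET.
  apply: matching_sub matM; apply/subsetP => D; rewrite inE => /mem_take.
  by rewrite mem_enum.
rewrite cardsE (card_uniqP _) ?take_uniq ?enum_uniq // size_take -cardE.
by case: ltngtP le_k => // ->.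
Qed.

(** The vertices of such a matching will be the face [F] with a disconnected
    link. *)
Definition avoiding_matching k (A : {set 'I_n}) := exists N,
  [/\ matching e N, #|N| = k, exists2 a, a \notin finset.cover N & a \in A
    & exists2 b, b \notin finset.cover N & b \notin A].

Lemma avoiding_matchingC k A : avoiding_matching k (~: A) -> avoiding_matching k A.
Proof.
case=> N [matN cN [b bN]]; rewrite inE => bA [a aN]; rewrite inE negbK => aA.
by exists N; split=> //; [exists a | exists b].
Qed.

Lemma avoiding_matching_remove k (A : {set 'I_n}) M D x y :
  matching e M -> #|M| = k.+1 -> D \in M ->
  x \notin finset.cover (M :\ D) -> x \in A ->
  y \notin finset.cover (M :\ D) -> y \notin A -> avoiding_matching k A.
Proof.
move=> matM cM DM xM xA yM yA; exists (M :\ D); split; [| |by exists x|by exists y].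
  by apply: matching_sub matM; apply: subD1set.
by apply: succn_inj; rewrite -cM (cardsD1 D M) DM.
Qed.

Lemma avoiding_matching_crossing k (A : {set 'I_n}) M x y :
  matching e M -> #|M| = k.+1 -> [set x; y]%SET \in M -> x \in A -> y \notin A ->
  avoiding_matching k A.
Proof.
move=> matM cM xyM xA yA; apply: (avoiding_matching_remove matM cM xyM _ xA _ yA).
  by apply: matching_remove xyM _ => //; apply: set21.
by apply: matching_remove xyM _ => //; apply: set22.
Qed.

(** If [y] is free, it is enough to remove [ab]. Otherwise [y] is matched to
    some [z]. If [z] is in [A], then [zy] crosses and can be removed.
    Otherwise [ab] and [yz] are exchanged for the crossing edge [bz], which
    frees [a] and [y]. *)
Lemma avoiding_matching_inner k (A : {set 'I_n}) M a b y :
  matching e M -> #|M| = k.+1 -> [set a; b]%SET \in M -> a \in A -> b \in A ->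
  y \notin A -> (forall c d, c \in A -> d \notin A -> e c d) ->
  avoiding_matching k A.
Proof.
move=> matM cM abM aA bA yA joinA.
have edgesM E : E \in M -> E \in edges e by case/andP: matM => /subsetP + _; apply.
have [yM|yM] := boolP (y \in finset.cover M); last first.
  apply: (avoiding_matching_remove matM cM abM _ aA _ yA).
    by apply: matching_remove abM _ => //; apply: set21.
  apply: contra yM => /bigcupP[E]; rewrite inE => /andP[_ EM] yE.
  by apply/bigcupP; exists E.
have [E EM yE] := bigcupP yM.
have [z def_E] : exists z, E = [set y; z]%SET.
  have /edgeP[i [j [_ def_E]]] := edgesM E EM.
  move: yE; rewrite def_E !inE => /orP[]/eqP ->; first by exists j.
  by exists i; rewrite setUC.
have [zA|zA] := boolP (z \in A).
  by apply: avoiding_matching_crossing matM cM _ zA yA; rewrite setUC -def_E.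
pose M1 := M :\ [set a; b]%SET; pose N := M1 :\ E.
have E_M1 : E \in M1.
  rewrite !inE EM andbT; apply: contraNneq yA => E_ab.
  by move: yE; rewrite E_ab !inE => /orP[]/eqP ->.
have matM1 : matching e M1 by apply: matching_sub matM; apply: subD1set.
have matN : matching e N by apply: matching_sub matM1; apply: subD1set.
have out_ab v : v \in [set a; b]%SET -> v \notin finset.cover N.
  move=> vab; apply: contra (matching_remove matM abM vab) => /bigcupP[G].
  by rewrite inE => /andP[_ GM] vG; apply/bigcupP; exists G.
have out_E v : v \in E -> v \notin finset.cover N by apply: matching_remove.
have [bN zN] : b \notin finset.cover N /\ z \notin finset.cover N.
  by split; [apply/out_ab/set22 | apply: out_E; rewrite def_E set22].
have [matN' cN'] := matching_add matN (joinA _ _ bA zA) bN zN.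
have edge_neqM i j : [set i; j]%SET \in M -> i != j.
  by move/edgesM/card_edge; rewrite cards2; case: (i == j).
have out v : v != b -> v != z -> v \notin finset.cover N ->
    v \notin finset.cover ([set b; z]%SET |: N).
  move=> vb vz vN; apply: contra vN => /bigcupP[G].
  rewrite !inE => /orP[/eqP -> |GN vG]; first by rewrite !inE (negbTE vb) (negbTE vz).
  by apply/bigcupP; exists G; rewrite ?inE.
exists ([set b; z]%SET |: N); split=> //.
- by apply: succn_inj; rewrite cN' -cM (cardsD1 [set a; b]%SET M) abM (cardsD1 E M1) E_M1.
- exists a => //; apply: out; [exact: edge_neqM| |exact/out_ab/set21].
  by apply: contraNneq zA => <-.
- exists y => //; apply: out; [|by apply: edge_neqM; rewrite -def_E|exact: out_E].
  by apply: contraNneq yA => ->.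
Qed.

Lemma exists_avoiding_matching (A : {set 'I_n}) k : (k < matching_number e)%N ->
  (exists a, a \in A) -> (exists b, b \notin A) ->
  (forall a b, a \in A -> b \notin A -> e a b) -> avoiding_matching k A.
Proof.
move=> lt_k [a0 a0A] [b0 b0A] joinA; have [e_sym _] := e_simple.
have [M matM cM] := exists_matching lt_k.
have [D DM] : exists D, D \in M by apply/set0Pn; rewrite -card_gt0 cM.
have /edgeP[a [b [eab def_D]]] : D \in edges e by case/andP: matM => /subsetP/(_ D DM).
rewrite def_D in DM.
have [aA|aA] := boolP (a \in A); have [bA|bA] := boolP (b \in A).
- exact: avoiding_matching_inner matM cM DM aA bA b0A joinA.
- exact: avoiding_matching_crossing matM cM DM aA bA.
- by apply: avoiding_matching_crossing matM cM _ bA aA; rewrite setUC.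
- apply: avoiding_matchingC; apply: (@avoiding_matching_inner _ _ _ a b a0 matM cM DM).
  + by rewrite inE.
  + by rewrite inE.
  + by rewrite inE negbK.
  + by move=> c d; rewrite !inE negbK => cA dA; rewrite e_sym joinA.
Qed.

(** The faces of the complex whose Stanley-Reisner ideal is the [k]-th
    squarefree power. *)
Definition matching_free k : {set 'I_n} -> Prop :=
  fun B => ~ exists M, [/\ matching e M, #|M| = k & finset.cover M \subset B].

Lemma matching_free_down k : down_closed (matching_free k).
Proof.
move=> A B sAB BD [M [matM cM sMA]]; apply: BD; exists M; split=> //.
exact: subset_trans sAB.
Qed.

Lemma matching_free_small k B : (#|B| < 2 * k)%N -> matching_free k B.
Proof.
move=> ltB [M [matM cM /subset_leq_card]].
by rewrite card_matching_cover // cM leqNgt ltB.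
Qed.

Lemma sqfree_powerE (K : fieldType) k :
  sqfree_power n K e k = face_ideal (matching_free k).
Proof.
pose ind (C : {set 'I_n}) : 'X_{1..n} := [multinom (i \in C : nat) | i < n].
have prodE M : matching e M ->
    \prod_(A in M) \prod_(i in A) 'X_i = 'X_[ind (finset.cover M)] :> {mpoly K[n]}.
  case/andP=> _ tM; rewrite -big_trivIset //= mpolyXE_id big_mkcond.
  by apply: eq_bigr => i _; rewrite mnmE; case: (_ \in _); rewrite ?expr0 ?expr1.
have downD := @matching_free_down k.
have idG : is_ideal (sqfree_power n K e k) by apply: ideal_gen_ideal.
apply/predeqP => p; split.
  apply: ideal_gen_min => [|_ [M [matM cM ->]] m]; first exact: face_ideal_ideal.
  rewrite prodE // mcoeffX; case: eqP => // <- []; exists M; split=> //.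
  by apply/subsetP => i iM; rewrite inE mnmE iM.
move=> pD; rewrite [p]mpolyE big_seq; apply: ideal_sum => // m.
rewrite mcoeff_msupp => /eqP pm.
have [M [matM cM sM]] : exists M, [/\ matching e M, #|M| = k & finset.cover M \subset varset m].
  by apply: contrapT => nM; apply/pm/pD.
have le_m : (ind (finset.cover M) <= m)%MM.
  apply/mnm_lepP => i; rewrite mnmE; case: (boolP (i \in _)) => //= /(subsetP sM).
  by rewrite inE lt0n.
rewrite -(submK le_m) mpolyXD scalerAl; case: (idG) => _ _; apply.
by apply: mem_ideal_gen; exists M; rewrite prodE.
Qed.

End Matchings.

(** * Normalized depth of squarefree powers *)

Lemma matching_number_gt0 n (e : rel 'I_n) i j : simple_graph e -> e i j ->
  (0 < matching_number e)%N.
Proof.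
move=> e_simple eij.
have mat0 : matching e set0.
  by rewrite /matching sub0set; apply/trivIsetP => A B; rewrite inE.
have c0 v : v \notin finset.cover (set0 : {set {set 'I_n}}) by rewrite /cover big_set0 inE.
have [mat1 c1] := matching_add e_simple mat0 eij (c0 i) (c0 j).
by apply: leq_trans (leq_bigmax_cond _ mat1); rewrite c1.
Qed.

(** Take for [A] a connected component of the complement of [G]; all the pairs
    with one vertex in [A] and the other outside are edges of [G]. *)
Lemma norm_depth_disconnected (K : fieldType) n (e : rel 'I_n) k :
  simple_graph e -> ~ connected_graph (compl_graph e) ->
  (1 <= k <= matching_number e)%N -> norm_depth n K e k = 0.
Proof.
move=> e_simple disc /andP[k_gt0 le_k].
have [i [j nij]] : exists i j, ~~ connect (compl_graph e) i j.
  apply: contrapT => nex; apply: disc => i j; apply: contrapT => /negP nij.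
  by apply: nex; exists i, j.
pose A := [set v | connect (compl_graph e) i v]%SET.
have joinA a b : a \in A -> b \notin A -> e a b.
  rewrite !inE => ia; apply: contraNT => neab; apply: connect_trans ia _.
  have [->|ne_ab] := eqVneq a b; first exact: connect0.
  by apply: connect1; rewrite /compl_graph ne_ab.
have [|||N [matN cN exA exB]] := @exists_avoiding_matching _ e e_simple A k.-1 _ _ _ joinA.
- by rewrite prednK.
- by exists i; rewrite inE connect0.
- by exists j; rewrite inE.
have cF : #|finset.cover N| = (2 * k.-1)%N by rewrite (card_matching_cover e_simple matN) cN.
rewrite /norm_depth sqfree_powerE //.
rewrite (@depth_disconnected_link _ _ _ (finset.cover N) A) //; first by rewrite cF; lia.
- exact: matching_free_down.
- by move=> B; rewrite cF => le_B; apply: matching_free_small => //; lia.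
- move=> u w uN wN uA wA; apply.
  have [matN' cN'] := matching_add e_simple matN (joinA _ _ uA wA) uN wN.
  exists ([set u; w]%SET |: N); split=> //; first by rewrite cN' cN prednK.
  rewrite /finset.cover; apply/bigcupsP => G; rewrite !inE => /orP[/eqP ->|GN].
    by apply/subsetP => v; rewrite !inE => /orP[]->; rewrite ?orbT.
  apply/subsetP => v vG; rewrite !inE; apply/orP; right; apply/orP; right.
  by apply/bigcupP; exists G.
Qed.

(** The singletons and the edges of the complement contain no edge of [G],
    hence [h_1, h_2] is a regular sequence and the depth is not [1]. *)
Lemma norm_depth1_connected (K : fieldType) n (e : rel 'I_n) i j :
  simple_graph e -> e i j -> connected_graph (compl_graph e) ->
  norm_depth n K e 1 <> 0.
Proof.
move=> e_simple eij conn; have [e_sym e_irr] := e_simple.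
have n_gt1 : (1 < n)%N.
  rewrite -[n]card_ord; apply: leq_trans (max_card [set i; j]%SET).
  by rewrite cards2 (edge_neq e_simple eij).
rewrite /norm_depth sqfree_powerE // => d0.
have depth1 : depth (face_ideal (K := K) (matching_free e 1)) = 1%N by lia.
suff : regular_length (face_ideal (K := K) (matching_free e 1)) 2.
  by move/regular_length_leq_depth; rewrite depth1 => /(_ isT).
apply: (@regular_length_face _ _ _ [:: complete_sym 1; complete_sym 2]).
- exact: matching_free_down.
- by apply: matching_free_small => //; rewrite cards0.
- by move=> f; rewrite !inE => /orP[]/eqP ->; apply: complete_sym_constant_term.
apply: (@regular_rec_complete_sym_connected _ _ _ (compl_graph e)) => // [|k|a b].
  exact: matching_free_down.
  by apply: matching_free_small => //; rewrite cards1.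
case/andP=> ne_ab /negP neab; split=> // -[M [/andP[sM _] cM sMab]]; apply: neab.
have /eqP/cards1P[D def_M] := cM.
have /edgeP[u [w [euw def_D]]] : D \in edges e by apply: (subsetP sM); rewrite def_M inE.
move: sMab; rewrite def_M /finset.cover big_set1 def_D subUset !sub1set !inE.
by case/andP=> /orP[]/eqP def_u /orP[]/eqP def_w; move: euw; rewrite def_u def_w ?e_irr // e_sym.
Qed.

Theorem corollary2p6 (K : fieldType) (n : nat) (e : rel 'I_n)
    (n_gt0 : (0 < n)%N)
    (e_simple : simple_graph e)
    (e_no_isolated : no_isolated e) :
  [<-> ~ connected_graph (compl_graph e);
       norm_depth n K e 1 = 0;
       forall k : nat, (1 <= k <= matching_number e)%N ->
         norm_depth n K e k = 0].
Proof.
have [j eij] := e_no_isolated (Ordinal n_gt0).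
have disc_all : ~ connected_graph (compl_graph e) ->
    forall k, (1 <= k <= matching_number e)%N -> norm_depth n K e k = 0.
  by move=> disc k; apply: norm_depth_disconnected.
have one_disc : norm_depth n K e 1 = 0 -> ~ connected_graph (compl_graph e).
  by move=> nd1 conn; apply: (norm_depth1_connected (K := K) e_simple eij conn).
have all_one : (forall k, (1 <= k <= matching_number e)%N -> norm_depth n K e k = 0) ->
    norm_depth n K e 1 = 0.
  by apply; rewrite (matching_number_gt0 e_simple eij).
by tfae => [/disc_all/all_one|/one_disc/disc_all|/all_one/one_disc].
Qed.
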